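(* Let $w\in F_2$ be any of the following words: $[x,y]$; $[x^m,y^n]$ with $m,n$ positive integers; $[x,y]^2$; $[x,y]^p$ with $p\ne2$ a prime number; $[[x,y],x[x,y]x^{-1}]$. Then the induced word map $\tilde w\colon\operatorname{PSL}(2,\mathbb C)^2\to\operatorname{PSL}(2,\mathbb C)$ is surjective.
   Context: $F_2$ is the free group on $x,y$, $[a,b]=aba^{-1}b^{-1}$, and $\tilde w(g_1,g_2)=w(g_1,g_2)$ is obtained by substitution. *)

(* Defs.v *)
From HB Require Import structures.
From mathcomp Require Import all_boot all_order all_algebra.
From mathcomp Require Import reals complex.

Set Implicit Arguments.
Unset Strict Implicit.
Unset Printing Implicit Defensive.

Import GRing.Theory.

(* [a, b] = a b a^-1 b^-1; MathComp's [~ a, b] is a^-1 b^-1 a b instead. *)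
Definition comm (G : groupType) (a b : G) : G := (a * b * a^-1 * b^-1)%g.

Section FreeGroup.
Variable T : choiceType.

(* The letter (t, false) stands for t and (t, true) for its formal inverse. *)
Definition letter := (T * bool)%type.

Implicit Types (a b : letter) (s t u : seq letter).

Definition linv a : letter := (a.1, ~~ a.2).

Definition reduced s := sorted (fun a b => b != linv a) s.

(* Left multiplication of a reduced word by a letter. *)
Definition lpush a s :=
  if s is b :: s' then if b == linv a then s' else a :: s else [:: a].

Definition wmul s t := foldr lpush t s.
Definition winv s := rev (map linv s).

Lemma linvK : involutive linv.
Proof. by case=> t b; rewrite /linv /= negbK. Qed.

Lemma reduced_cons a s :
  reduced (a :: s) = (if s is b :: _ then b != linv a else true) && reduced s.
Proof. by case: s. Qed.

Lemma reduced_behead a s : reduced (a :: s) -> reduced s.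
Proof. by rewrite reduced_cons => /andP[]. Qed.

Lemma reduced_lpush a s : reduced s -> reduced (lpush a s).
Proof.
case: s => //= b s rs; case: ifP => [_|neq_ba]; first exact: reduced_behead rs.
by rewrite reduced_cons neq_ba.
Qed.

Lemma lpushK a s : reduced s -> lpush (linv a) (lpush a s) = s.
Proof.
case: s => [|b s] rs; first by rewrite /= linvK eqxx.
rewrite [lpush a _]/=; case: eqP rs => [->|_] rs; last by rewrite /= linvK eqxx.
by case: s rs => [|c s] //= /andP[/negPf->].
Qed.

Lemma lpushVK a s : reduced s -> lpush a (lpush (linv a) s) = s.
Proof. by move=> rs; rewrite -{1}[a]linvK lpushK. Qed.

Lemma reduced_wmul s t : reduced t -> reduced (wmul s t).
Proof. by move=> rt; elim: s => //= a s; apply: reduced_lpush. Qed.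

Lemma wmul_lpush a s u : reduced u -> wmul (lpush a s) u = lpush a (wmul s u).
Proof.
case: s => [|b s] ru //=; case: eqP => [->|//] /=.
by rewrite lpushVK //; apply: reduced_wmul.
Qed.

Lemma wmulA s t u : reduced u -> wmul s (wmul t u) = wmul (wmul s t) u.
Proof. by move=> ru; elim: s => //= a s ->; rewrite wmul_lpush. Qed.

Lemma wmulw1 s : reduced s -> wmul s [::] = s.
Proof.
elim: s => // a s IHs rs; rewrite /= IHs ?(reduced_behead rs) //.
by case: s rs {IHs} => //= b s /andP[/negPf->].
Qed.

Lemma winvK : involutive winv.
Proof. by move=> s; rewrite /winv map_rev revK mapK //; apply: linvK. Qed.

Lemma reduced_winv s : reduced s -> reduced (winv s).
Proof.
move=> rs; rewrite /reduced /winv rev_sorted sorted_map.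
by apply: sub_sorted rs => a b /=; rewrite linvK eq_sym.
Qed.

Lemma wmulK s t : reduced t -> wmul (winv s) (wmul s t) = t.
Proof.
move=> rt; elim: s => // a s IHs.
rewrite /winv /= rev_cons /wmul foldr_rcons -/(wmul s t).
by rewrite lpushK //; apply: reduced_wmul.
Qed.

Record freeGroup := FreeGroup { fgword :> seq letter; _ : reduced fgword }.

HB.instance Definition _ := [isSub for fgword].
HB.instance Definition _ := [Choice of freeGroup by <:].

Implicit Types (v w : freeGroup).

Lemma fgwordP w : reduced w. Proof. exact: valP. Qed.

Definition fgone := @FreeGroup [::] isT.
Definition fginv w := FreeGroup (reduced_winv (fgwordP w)).
Definition fgmul v w := FreeGroup (reduced_wmul v (fgwordP w)).

Lemma fgmulA : associative fgmul.
Proof. by move=> u v w; apply: val_inj; apply: wmulA (fgwordP w). Qed.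

Lemma fgmul1w : left_id fgone fgmul.
Proof. by move=> w; apply: val_inj. Qed.

Lemma fgmulw1 : right_id fgone fgmul.
Proof. by move=> w; apply: val_inj; apply: wmulw1 (fgwordP w). Qed.

Lemma fgmulVw : left_inverse fgone fginv fgmul.
Proof.
move=> w; apply: val_inj; rewrite /= -{2}(wmulw1 (fgwordP w)).
exact: wmulK.
Qed.

Lemma fginvK : involutive fginv.
Proof. by move=> w; apply: val_inj; apply: winvK. Qed.

Lemma fgmulwV : right_inverse fgone fginv fgmul.
Proof. by move=> w; rewrite -{1}[w]fginvK fgmulVw. Qed.

HB.instance Definition _ :=
  isGroup.Build freeGroup fgmulA fgmul1w fgmulw1 fgmulVw fgmulwV.

Definition fggen (t : T) : freeGroup := @FreeGroup [:: (t, false)] isT.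

End FreeGroup.

Section Evaluation.
Variables (T : choiceType) (G : groupType).
Local Open Scope group_scope.

Definition leval (f : T -> G) (a : letter T) : G :=
  if a.2 then (f a.1)^-1 else f a.1.

Definition fgeval (f : T -> G) (w : freeGroup T) : G :=
  \prod_(a <- fgword w) leval f a.

Variable f : T -> G.

Lemma leval_inv a : leval f (linv a) = (leval f a)^-1.
Proof. by case: a => t [] //=; rewrite /leval /= invgK. Qed.

Lemma prod_lpush a s :
  \prod_(b <- lpush a s) leval f b = leval f a * \prod_(b <- s) leval f b.
Proof.
case: s => [|b s] /=; first by rewrite big_cons.
case: eqP => [->|_]; last by rewrite big_cons.
by rewrite big_cons leval_inv mulVKg.
Qed.

Lemma fgeval1 : fgeval f 1 = 1. Proof. exact: big_nil. Qed.

Lemma fgevalM : {morph fgeval f : v w / v * w}.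
Proof.
move=> [s rs] [t rt]; rewrite /fgeval /= {rs rt}.
elim: s => [|a s IHs] /=; first by rewrite big_nil mul1g.
by rewrite prod_lpush IHs big_cons mulgA.
Qed.

HB.instance Definition _ :=
  isUMagmaMorphism.Build (freeGroup T) G (fgeval f) (fgeval1, fgevalM).

Lemma fgevalV w : fgeval f w^-1 = (fgeval f w)^-1. Proof. exact: gmulfV. Qed.

Lemma fgevalX w n : fgeval f (w ^+ n) = fgeval f w ^+ n.
Proof. exact: gmulfXn. Qed.

Lemma fgeval_gen t : fgeval f (fggen t) = f t.
Proof. by rewrite /fgeval big_seq1. Qed.

Lemma fgeval_comm v w :
  fgeval f (comm v w) = comm (fgeval f v) (fgeval f w).
Proof. by rewrite /comm !fgevalM !fgevalV. Qed.

Lemma fgeval_uniq (h : freeGroup T -> G) :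
  {morph h : v w / v * w} -> (forall t, h (fggen t) = f t) -> h =1 fgeval f.
Proof.
move=> hM hgen.
have h1 : h 1 = 1 by apply: (mulgI (h 1)); rewrite -hM !mulg1.
have hV w : h w^-1 = (h w)^-1.
  by apply: (mulgI (h w)); rewrite -hM !mulgV.
case=> s; elim: s => [|a s IHs] rs.
  by rewrite /fgeval big_nil -h1; congr h; apply: val_inj.
have -> : FreeGroup rs
    = @FreeGroup _ [:: a] isT * FreeGroup (reduced_behead rs).
  apply: val_inj; rewrite /= /lpush.
  by case: s rs {IHs} => //= b s /andP[/negPf->].
rewrite hM fgevalM IHs; congr (_ * _); rewrite /fgeval big_seq1.
case: a {rs} => t [] /=; rewrite /leval /= -hgen -?hV;
  by congr h; apply: val_inj.
Qed.

End Evaluation.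

Definition F2 := freeGroup bool.
HB.instance Definition _ := Group.on F2.

Definition F2x : F2 := fggen false.
Definition F2y : F2 := fggen true.

Definition word_map (G : groupType) (w : F2) (g : G * G) : G :=
  fgeval (fun b : bool => if b then g.2 else g.1) w.

Section PSL2.
Variable F : fieldType.
Local Open Scope ring_scope.
Local Open Scope quotient_scope.

Record SL2 := MkSL2 { sl2mx :> 'M[F]_2; _ : \det sl2mx == 1 }.

HB.instance Definition _ := [isSub for sl2mx].
HB.instance Definition _ := [Choice of SL2 by <:].

Implicit Types A B : SL2.

Lemma det_sl2 A : \det A = 1. Proof. by case: A => /= M /eqP. Qed.

Lemma sl2_unit A : sl2mx A \in unitmx.
Proof. by rewrite unitmxE det_sl2 unitr1. Qed.

Fact sl2_one_subproof : \det (1%:M : 'M[F]_2) == 1.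
Proof. by rewrite det1. Qed.
Definition sl2_one := MkSL2 sl2_one_subproof.

Fact sl2_mul_subproof A B : \det (A *m B) == 1.
Proof. by rewrite det_mulmx !det_sl2 mulr1. Qed.
Definition sl2_mul A B := MkSL2 (sl2_mul_subproof A B).

Fact sl2_inv_subproof A : \det (invmx A) == 1.
Proof. by rewrite det_inv det_sl2 invr1. Qed.
Definition sl2_inv A := MkSL2 (sl2_inv_subproof A).

Lemma sl2_mulA : associative sl2_mul.
Proof. by move=> A B C; apply/val_inj/mulmxA. Qed.
Lemma sl2_mul1A : left_id sl2_one sl2_mul.
Proof. by move=> A; apply/val_inj/mul1mx. Qed.
Lemma sl2_mulA1 : right_id sl2_one sl2_mul.
Proof. by move=> A; apply/val_inj/mulmx1. Qed.
Lemma sl2_mulVA : left_inverse sl2_one sl2_inv sl2_mul.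
Proof. by move=> A; apply/val_inj/mulVmx/sl2_unit. Qed.
Lemma sl2_mulAV : right_inverse sl2_one sl2_inv sl2_mul.
Proof. by move=> A; apply/val_inj/mulmxV/sl2_unit. Qed.

HB.instance Definition _ :=
  isGroup.Build SL2 sl2_mulA sl2_mul1A sl2_mulA1 sl2_mulVA sl2_mulAV.

(* A and B are in the same coset of {1, -1}. *)
Definition sl2_pm A B := (sl2mx A == sl2mx B) || (sl2mx A == - sl2mx B).

Lemma sl2_pmP A B :
  reflect (exists b : bool, sl2mx A = (-1) ^+ b *: sl2mx B) (sl2_pm A B).
Proof.
apply: (iffP orP) => [[]/eqP->|[[] ->]].
- by exists false; rewrite scale1r.
- by exists true; rewrite scaleN1r.
- by right; rewrite scaleN1r.
- by left; rewrite scale1r.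
Qed.

Lemma sl2_pm_refl : reflexive sl2_pm.
Proof. by move=> A; rewrite /sl2_pm eqxx. Qed.

Lemma sl2_pm_sym : symmetric sl2_pm.
Proof. by move=> A B; rewrite /sl2_pm eq_sym -eqr_oppLR [- _ == _]eq_sym. Qed.

Lemma sl2_pm_trans : transitive sl2_pm.
Proof.
move=> B A C /sl2_pmP[b AB] /sl2_pmP[c BC]; apply/sl2_pmP; exists (b (+) c).
by rewrite AB BC scalerA signr_addb.
Qed.

Canonical sl2_pm_equiv := EquivRel sl2_pm sl2_pm_refl sl2_pm_sym sl2_pm_trans.

Definition PSL2 := {eq_quot sl2_pm}.
HB.instance Definition _ := Choice.on PSL2.
HB.instance Definition _ := EqQuotient.on PSL2.

Definition psl2_one : PSL2 := \pi_PSL2 sl2_one.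
Definition psl2_mul (u v : PSL2) : PSL2 := \pi_PSL2 (sl2_mul (repr u) (repr v)).
Definition psl2_inv (u : PSL2) : PSL2 := \pi_PSL2 (sl2_inv (repr u)).

Lemma sl2_pm_repr A : sl2_pm (repr (\pi_PSL2 A)) A.
Proof. by apply/eqmodP; rewrite reprK. Qed.

Lemma pi_psl2_mul A B :
  \pi_PSL2 (sl2_mul A B) = psl2_mul (\pi_PSL2 A) (\pi_PSL2 B).
Proof.
apply/esym/eqmodP/sl2_pmP.
have /sl2_pmP[b Ab] := sl2_pm_repr A; have /sl2_pmP[c Bc] := sl2_pm_repr B.
by exists (b (+) c); rewrite /= Ab Bc -scalemxAl -scalemxAr scalerA signr_addb.
Qed.

Lemma pi_psl2_inv A : \pi_PSL2 (sl2_inv A) = psl2_inv (\pi_PSL2 A).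
Proof.
apply/esym/eqmodP/sl2_pmP; have /sl2_pmP[b Ab] := sl2_pm_repr A.
by exists b; rewrite /= Ab invmxZ ?invr_sign // -Ab sl2_unit.
Qed.

Lemma psl2_mulA : associative psl2_mul.
Proof.
elim/quotW=> A; elim/quotW=> B; elim/quotW=> C.
rewrite -(pi_psl2_mul B C) -(pi_psl2_mul A B).
by rewrite -(pi_psl2_mul A) -(pi_psl2_mul (sl2_mul A B)) sl2_mulA.
Qed.
Lemma psl2_mul1u : left_id psl2_one psl2_mul.
Proof. by elim/quotW=> A; rewrite -(pi_psl2_mul sl2_one) sl2_mul1A. Qed.
Lemma psl2_mulu1 : right_id psl2_one psl2_mul.
Proof. by elim/quotW=> A; rewrite -(pi_psl2_mul A) sl2_mulA1. Qed.
Lemma psl2_mulVu : left_inverse psl2_one psl2_inv psl2_mul.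
Proof. by elim/quotW=> A; rewrite -pi_psl2_inv -(pi_psl2_mul _ A) sl2_mulVA. Qed.
Lemma psl2_muluV : right_inverse psl2_one psl2_inv psl2_mul.
Proof. by elim/quotW=> A; rewrite -pi_psl2_inv -(pi_psl2_mul A) sl2_mulAV. Qed.

HB.instance Definition _ :=
  isGroup.Build PSL2 psl2_mulA psl2_mul1u psl2_mulu1 psl2_mulVu psl2_muluV.

End PSL2.

(* Main.v *)
Require Import Defs.
From mathcomp Require Import all_boot all_order all_algebra.
From mathcomp Require Import reals complex.
From mathcomp Require Import ring.

Import GRing.Theory Num.Theory.

(** The longest word w = [c, x c x^-1], with c = [x, y], carries the whole
    theorem: its values are commutators, so surjectivity of w gives that of
    [x, y], and since every element of PSL(2, K), K algebraically closed of
    characteristic 0, has an n-th root for all n > 0, the words [x^m, y^n] and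
    [x, y]^p follow.

    Both w and u |-> u^n have an image stable under conjugation.  Over a field,
    two non-scalar 2x2 matrices with equal trace and determinant are conjugate
    (both are similar to their companion matrix, [companion_similar]), and over
    an algebraically closed field the conjugating matrix can be taken in SL2
    ([sl2_conj]).  A set that contains 1 and is stable under conjugation is
    therefore all of PSL(2, K) as soon as it contains the class of a non-scalar
    matrix of each trace t; one nonzero value e of t may even be left out,
    since a matrix of trace e has the same class as its opposite, whose trace
    is -e ([psl2_trace_criterion]).

    For w, take x = [[s, 1], [-1, 0]] and y = diag(i, -i): the matrix
    w(x, y) has trace 2 + 16 s^4 and lower left entry -8 s^3, so it is
    non-scalar of arbitrary trace t <> 2 ([double_comm_word_surj]).  For n-th
    powers, the upper triangular matrices with diagonal (r, 1/r) give every
    trace t <> -2 ([psl2_root]). *)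

(** * Words and homomorphisms *)

Section Words.
Local Open Scope group_scope.
Set Implicit Arguments.
Unset Strict Implicit.

Lemma fgeval_morph (T : choiceType) (G H : groupType) (phi : G -> H)
    (f : T -> G) :
  {morph phi : u v / u * v} ->
  forall w : freeGroup T, phi (fgeval f w) = fgeval (phi \o f) w.
Proof.
move=> phiM; apply: (fgeval_uniq (h := phi \o fgeval f)) => [u v|t] /=.
  by rewrite fgevalM phiM.
by rewrite fgeval_gen.
Qed.

Lemma word_map_morph (G H : groupType) (phi : G -> H) (w : F2) (a b : G) :
  {morph phi : u v / u * v} ->
  phi (word_map w (a, b)) = word_map w (phi a, phi b).
Proof.
move=> phiM; rewrite /word_map (fgeval_morph _ phiM).
by rewrite /fgeval; apply: eq_bigr => -[[] []].
Qed.

Lemma word_map1 (G : groupType) (w : F2) : word_map w (1, 1) = 1 :> G.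
Proof.
have triv : {morph (fun _ : G => 1 : G) : u v / u * v}.
  by move=> u v; rewrite mulg1.
by rewrite -(word_map_morph w 1 1 triv).
Qed.

Lemma word_mapM (G : groupType) (v w : F2) (g : G * G) :
  word_map (v * w) g = word_map v g * word_map w g.
Proof. exact: (fgevalM _ v w). Qed.

Lemma word_mapV (G : groupType) (w : F2) (g : G * G) :
  word_map w^-1 g = (word_map w g)^-1.
Proof. exact: (fgevalV _ w). Qed.

Lemma word_mapX (G : groupType) (w : F2) n (g : G * G) :
  word_map (w ^+ n) g = word_map w g ^+ n.
Proof. exact: (fgevalX _ w n). Qed.

Lemma word_map_comm (G : groupType) (v w : F2) (g : G * G) :
  word_map (comm v w) g = comm (word_map v g) (word_map w g).
Proof. exact: (fgeval_comm _ v w). Qed.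

Lemma word_mapx (G : groupType) (g : G * G) : word_map F2x g = g.1.
Proof. exact: fgeval_gen. Qed.

Lemma word_mapy (G : groupType) (g : G * G) : word_map F2y g = g.2.
Proof. exact: fgeval_gen. Qed.

Lemma comm_eq (G : groupType) (a b c : G) :
  a * b = c * (b * a) -> comm a b = c.
Proof. by rewrite /comm => ->; rewrite !mulgA !mulgK. Qed.

Definition double_comm (G : groupType) (x y : G) :=
  comm (comm x y) (x * comm x y * x^-1).

Lemma word_map_double_comm (G : groupType) (g : G * G) :
  word_map (double_comm F2x F2y) g = double_comm g.1 g.2.
Proof.
rewrite /double_comm.
by rewrite !(word_map_comm, word_mapM, word_mapV, word_mapx, word_mapy).
Qed.

End Words.

(** * Two by two matrices *)

Section Matrices.
Local Open Scope ring_scope.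
Set Implicit Arguments.
Unset Strict Implicit.
Variable K : fieldType.
Implicit Types A B P : 'M[K]_2.

Definition mx2 (a b c d : K) : 'M[K]_2 :=
  \matrix_(i, j) (if i == 0 then if j == 0 then a else b
                  else if j == 0 then c else d).

Lemma mx2E A : A = mx2 (A 0 0) (A 0 1) (A 1 0) (A 1 1).
Proof.
apply/matrixP => i j; rewrite mxE.
by case: (unliftP 0 i) => [i'|] ->; case: (unliftP 0 j) => [j'|] -> //=;
  rewrite ?(ord1 i') ?(ord1 j'); congr (A _ _); apply: val_inj.
Qed.

Lemma mx2_eta A : exists a b c d, A = mx2 a b c d.
Proof. by do 4!eexists; apply: mx2E. Qed.

Lemma mx2_mul a b c d a' b' c' d' :
  mx2 a b c d *m mx2 a' b' c' d' =
  mx2 (a * a' + b * c') (a * b' + b * d') (c * a' + d * c') (c * b' + d * d').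
Proof.
apply/matrixP => i j; rewrite !mxE !big_ord_recl big_ord0 !mxE addr0 /=.
by case: ifP; case: ifP.
Qed.

Lemma mx2_trace a b c d : \tr (mx2 a b c d) = a + d.
Proof. by rewrite /mxtrace !big_ord_recl big_ord0 !mxE addr0. Qed.

Lemma mx2_det a b c d : \det (mx2 a b c d) = a * d - b * c.
Proof.
rewrite (expand_det_row _ 0) !big_ord_recl big_ord0 /cofactor !det_mx11 !mxE /=.
by rewrite expr0 expr1; ring.
Qed.

Lemma mx2_1 : 1%:M = mx2 1 0 0 1.
Proof. by rewrite [LHS]mx2E !mxE. Qed.

Lemma mx2_scalar a b c d :
  is_scalar_mx (mx2 a b c d) = [&& a == d, b == 0 & c == 0].
Proof.
apply/is_scalar_mxP/and3P => [[k /matrixP E]|[/eqP-> /eqP-> /eqP->]].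
  have := (E 0 0, E 0 1, E 1 0, E 1 1).
  by rewrite !mxE /= => -[[[-> ->] ->] ->].
by exists d; rewrite [RHS]mx2E !mxE.
Qed.

Definition companion2 A := mx2 0 (- \det A) 1 (\tr A).

(** If v and A v are linearly independent then, by Cayley-Hamilton, A acts on
    the basis (v, A v) as its companion matrix.  Such a v exists because A is
    non-scalar: one of e1, e2 and e1 + e2 will do. *)
Lemma companion_similar A : ~~ is_scalar_mx A ->
  exists2 P, \det P != 0 & A *m P = P *m companion2 A.
Proof.
have [a [b [c [d ->]]]] := mx2_eta A; rewrite mx2_scalar => nsA.
have cyclic u v : u * (c * u + d * v) - (a * u + b * v) * v != 0 ->
    exists2 P, \det P != 0
      & mx2 a b c d *m P = P *m companion2 (mx2 a b c d).
  move=> indep; exists (mx2 u (a * u + b * v) v (c * u + d * v)).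
    by rewrite mx2_det.
  by rewrite /companion2 mx2_det mx2_trace !mx2_mul; congr mx2; ring.
have [c0|c_n0] := eqVneq c 0; last first.
  by apply: (cyclic 1 0); rewrite !mulr1 !mulr0 addr0 mul1r subr0.
have [b0|b_n0] := eqVneq b 0; last first.
  by apply: (cyclic 0 1); rewrite mul0r sub0r mulr0 add0r !mulr1 oppr_eq0.
apply: (cyclic 1 1); rewrite b0 c0 !mulr1 mul1r add0r addr0 subr_eq0 eq_sym.
by move: nsA; rewrite b0 c0 eqxx !andbT.
Qed.

End Matrices.

(** * Conjugacy classes in SL2 and PSL2 *)

Section SL2.
Local Open Scope ring_scope.
Set Implicit Arguments.
Unset Strict Implicit.
Variable K : fieldType.
Implicit Types A B P : SL2 K.

Fact sl2_of_subproof (a b c d : K) :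
  a * d - b * c = 1 -> \det (mx2 a b c d) == 1.
Proof. by rewrite mx2_det => ->. Qed.

Definition sl2_of a b c d (e : a * d - b * c = 1) : SL2 K :=
  MkSL2 (sl2_of_subproof e).

Lemma sl2mxM A B : sl2mx (A * B)%g = sl2mx A *m sl2mx B.
Proof. by []. Qed.

Definition psl2_of A : PSL2 K := (\pi_(PSL2 K) A)%qT.

Lemma psl2_ofM : {morph psl2_of : A B / (A * B)%g}.
Proof. exact: pi_psl2_mul. Qed.

Lemma psl2_of1 : psl2_of 1%g = 1%g.
Proof. by []. Qed.

Lemma psl2_ofV A : psl2_of A^-1%g = (psl2_of A)^-1%g.
Proof. exact: pi_psl2_inv. Qed.

Lemma psl2_ofX A n : psl2_of (A ^+ n)%g = (psl2_of A ^+ n)%g.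
Proof.
by elim: n => [|n IHn]; rewrite ?expg0 ?psl2_of1 // !expgS psl2_ofM IHn.
Qed.

Fact sl2_opp_subproof A : \det (- sl2mx A) == 1.
Proof. by rewrite -scaleN1r detZ det_sl2 mulr1 sqrrN expr1n. Qed.
Definition sl2_opp A : SL2 K := MkSL2 (sl2_opp_subproof A).

Lemma psl2_of_opp A : psl2_of (sl2_opp A) = psl2_of A.
Proof. by apply/eqmodP; rewrite /= /sl2_pm eqxx orbT. Qed.

Lemma psl2_of_scalar A : is_scalar_mx A -> psl2_of A = 1%g.
Proof.
case/is_scalar_mxP => k Ak; have := det_sl2 A; rewrite Ak det_scalar => k2.
apply/eqmodP; rewrite /= /sl2_pm /= Ak.
have /orP[/eqP->|/eqP->] : (k == 1) || (k == -1) by rewrite -sqrf_eq1 k2.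
  by rewrite eqxx.
by rewrite raddfN eqxx orbT.
Qed.

End SL2.

Section Closed.
Local Open Scope ring_scope.
Set Implicit Arguments.
Unset Strict Implicit.
Variable K : numClosedFieldType.
Implicit Types A B P : SL2 K.

Lemma sl2_conj A B :
  ~~ is_scalar_mx A -> ~~ is_scalar_mx B -> \tr A = \tr B ->
  exists P, A = (B ^ P)%g.
Proof.
move=> /companion_similar[P P_n0 AP] /companion_similar[Q Q_n0 BQ] tAB.
have {}AP : sl2mx A *m P = P *m companion2 B.
  by rewrite AP /companion2 tAB !det_sl2.
have uP : P \in unitmx by rewrite unitmxE unitfE.
pose T := Q *m invmx P.
have T_n0 : \det T != 0 by rewrite det_mulmx det_inv mulf_neq0 ?invr_eq0.
have BT : sl2mx B *m T = T *m sl2mx A.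
  rewrite /T mulmxA BQ -!mulmxA; congr (_ *m _).
  by rewrite -[LHS](mulKmx uP); congr (_ *m _); rewrite mulmxA -AP mulmxK.
(* Dividing T by a square root of its determinant puts it in SL2. *)
have dT : \det ((sqrtC (\det T))^-1 *: T) == 1.
  by rewrite detZ exprVn sqrtCK mulVf.
exists (MkSL2 dT); rewrite conjgE; apply: (mulgI (MkSL2 dT)); rewrite mulVKg.
by apply: val_inj; rewrite /= -scalemxAr BT -scalemxAl.
Qed.

(** The class in PSL2 of a non-scalar matrix is determined up to conjugation by
    its trace up to sign, because equal trace gives conjugate lifts and the
    two lifts of a class have opposite traces.  The sign makes it possible to
    ignore one trace e, which suits word maps with an exceptional trace. *)
Lemma psl2_trace_criterion (e : K) (S : PSL2 K -> Prop) :
    e != 0 -> S 1%g -> (forall z p, S z -> S (z ^ p)%g) ->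
    (forall t, t != e ->
       exists B, [/\ ~~ is_scalar_mx B, \tr B = t & S (psl2_of B)]) ->
  forall z, S z.
Proof.
move=> e_n0 S1 SJ St z; rewrite -[z]reprK -/(psl2_of _).
move: (repr z) => {z} A.
wlog tA : A / \tr A != e => [IH|].
  have [tA|] := eqVneq (\tr A) e; last exact: IH.
  rewrite -psl2_of_opp; apply: IH; rewrite /= raddfN /= tA.
  by rewrite eq_sym -addr_eq0 -mulr2n mulrn_eq0.
have [/psl2_of_scalar-> //|nsA] := boolP (is_scalar_mx A).
have [B [nsB tB SB]] := St _ tA.
have [P ->] := sl2_conj nsA nsB (esym tB).
by rewrite conjgE !psl2_ofM psl2_ofV -conjgE; apply: SJ.
Qed.

(** * Roots and word maps in PSL2 *)

Lemma upper_det (r : K) : r != 0 -> r * r^-1 - 1 * 0 = 1.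
Proof. by move=> r_n0; rewrite mulr0 subr0 mulfV. Qed.

Lemma upper_exp (r : K) (r_n0 : r != 0) n :
  exists2 q, sl2mx (sl2_of (upper_det r_n0) ^+ n)%g
             = mx2 (r ^+ n) q 0 (r ^- n)
  & r = 1 -> q = n%:R.
Proof.
elim: n => [|n [q E q1]]; first by exists 0; rewrite // invr1 -mx2_1.
exists (r * q + r ^- n).
  rewrite expgS sl2mxM E /= mx2_mul !mul0r !mulr0 addr0 !add0r mul1r.
  by rewrite exprS invfM.
by move=> r1; rewrite q1 // r1 expr1n invr1 mul1r natr1.
Qed.

(** Write t = a + 1/a and r^n = a: the n-th power of the upper triangular
    matrix with diagonal (r, 1/r) has diagonal (a, 1/a), hence is non-scalar
    unless a = 1 or a = -1.  For a = 1 the choice r = 1 gives a nontrivial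
    unipotent, as the characteristic is 0; a = -1 is the excluded t = -2. *)
Lemma psl2_root n (z : PSL2 K) : (0 < n)%N -> exists u, (u ^+ n)%g = z.
Proof.
move=> n_gt0; move: z; apply: (@psl2_trace_criterion (-2)).
- by rewrite oppr_eq0 pnatr_eq0.
- by exists 1%g; rewrite expg1n.
- by move=> z p [u <-]; exists (u ^ p)%g; rewrite conjXg.
move=> t tN2; pose a := (t + sqrtC (t ^+ 2 - 4)) / 2.
have aE : a * a + 1 = t * a.
  have D : sqrtC (t ^+ 2 - 4) ^+ 2 = t ^+ 2 - 4 by exact: sqrtCK.
  rewrite /a; move: (sqrtC _) D => D D2.
  by field: D2.
have a_n0 : a != 0.
  by apply: contra_eq_neq aE => ->; rewrite !mulr0 add0r oner_eq0.
have tE : a + a^-1 = t by apply: (mulIf a_n0); rewrite mulrDl mulVf.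
have [r [rn r1]] : exists r, r ^+ n = a /\ (a = 1 -> r = 1).
  have [->|a_n1] := eqVneq a 1; first by exists 1; rewrite expr1n.
  exists (n.-root a); rewrite rootCK //; split=> // /eqP.
  by rewrite (negPf a_n1).
have r_n0 : r != 0.
  by apply: contraNneq a_n0 => r0; rewrite -rn r0 expr0n gtn_eqF.
have [q E q1] := upper_exp r_n0 n; rewrite rn in E.
exists (sl2_of (upper_det r_n0) ^+ n)%g; split.
- rewrite E mx2_scalar eqxx andbT; apply/negP => /andP[/eqP aV /eqP q0].
  have /orP[/eqP a1|/eqP aN1] : (a == 1) || (a == -1).
  + by rewrite -sqrf_eq1 expr2 {2}aV mulfV.
  + by have /eqP := q1 (r1 a1); rewrite q0 eq_sym pnatr_eq0 gtn_eqF.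
  + by case/eqP: tN2; rewrite -tE aN1 invrN1 -opprD.
- by rewrite E mx2_trace.
- by exists (psl2_of (sl2_of (upper_det r_n0))); rewrite psl2_ofX.
Qed.

(** Conjugation by y = diag(i, -i) negates the off-diagonal entries of a matrix;
    applied to the inverse of x = [[s, 1], [-1, 0]] it gives
    [x, y] = - [[1, -2s], [0, 1]].  Up to sign, [x, y] and its conjugate by x
    are thus two transvections, with distinct axes when s is nonzero. *)
Lemma double_comm_entries (s : K) :
  exists x y : SL2 K,
    sl2mx (double_comm x y)
    = mx2 (1 - 4 * s ^+ 2 + 24 * s ^+ 4) (24 * s ^+ 5 - 16 * s ^+ 3)
          (- 8 * s ^+ 3) (1 + 4 * s ^+ 2 - 8 * s ^+ 4).
Proof.
have i2 : 'i * 'i = -1 :> K by rewrite -expr2 sqrCi.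
have dx : s * 0 - 1 * -1 = 1 by ring.
have dy : 'i * - 'i - 0 * 0 = 1 :> K by rewrite mulrN i2; ring.
have dc : -1 * -1 - 2 * s * 0 = 1 by ring.
have dd : (2 * s ^+ 2 - 1) * (- 1 - 2 * s ^+ 2) - 2 * s ^+ 3 * (- 2 * s) = 1.
  by ring.
have dw : (1 - 4 * s ^+ 2 + 24 * s ^+ 4) * (1 + 4 * s ^+ 2 - 8 * s ^+ 4)
          - (24 * s ^+ 5 - 16 * s ^+ 3) * (- 8 * s ^+ 3) = 1 by ring.
pose x := sl2_of dx; pose y := sl2_of dy; pose c := sl2_of dc.
pose d := sl2_of dd; exists x, y.
have Ec : comm x y = c.
  apply: comm_eq; apply: val_inj; rewrite /= !mx2_mul; congr mx2; ring: i2.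
have Ed : (x * c * x^-1)%g = d.
  apply: (mulIg x); rewrite mulgVK; apply: val_inj.
  by rewrite /= !mx2_mul; congr mx2; ring.
suff -> : double_comm x y = sl2_of dw by [].
rewrite /double_comm Ec Ed; apply: comm_eq; apply: val_inj.
by rewrite /= !mx2_mul; congr mx2; ring.
Qed.

Lemma double_comm_word_surj (z : PSL2 K) :
  exists g, word_map (double_comm F2x F2y) g = z.
Proof.
move: z; apply: (@psl2_trace_criterion 2).
- by rewrite pnatr_eq0.
- by exists (1%g, 1%g); apply: word_map1.
- move=> z p [[a b] <-]; exists ((a ^ p)%g, (b ^ p)%g).
  by rewrite -(word_map_morph (phi := conjg^~ p)) // => u v; apply: conjMg.
move=> t t_n2; pose s := 4.-root ((t - 2) / 16).
have s4 : s ^+ 4 = (t - 2) / 16 by apply: rootCK.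
have s_n0 : s != 0.
  by rewrite rootC_eq0 // mulf_eq0 invr_eq0 pnatr_eq0 orbF subr_eq0.
have [x [y E]] := double_comm_entries s.
exists (double_comm x y); rewrite E; split.
- rewrite mx2_scalar mulNr oppr_eq0 mulf_eq0 pnatr_eq0 expf_eq0 (negPf s_n0).
  by rewrite !andbF.
- rewrite mx2_trace; transitivity (2 + 16 * s ^+ 4); first by ring.
  by rewrite s4; field.
- exists (psl2_of x, psl2_of y).
  rewrite -(word_map_morph _ _ _ (@psl2_ofM K)); congr psl2_of.
  exact: word_map_double_comm.
Qed.

Lemma comm_surj (z : PSL2 K) : exists a b, comm a b = z.
Proof.
have [g <-] := double_comm_word_surj z.
by rewrite word_map_double_comm; do 2!eexists.
Qed.

End Closed.

Theorem corollary4p21 (R : realType) (w : F2)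
  (hw : w = comm F2x F2y
     \/ (exists m n : nat, [/\ (0 < m)%N, (0 < n)%N
           & w = comm (F2x ^+ m)%g (F2y ^+ n)%g])
     \/ w = (comm F2x F2y ^+ 2)%g
     \/ (exists p : nat, [/\ prime p, p <> 2%N & w = (comm F2x F2y ^+ p)%g])
     \/ w = comm (comm F2x F2y) (F2x * comm F2x F2y * F2x^-1)%g) :
  forall z : PSL2 (complex R), exists g : PSL2 (complex R) * PSL2 (complex R),
    word_map w g = z.
Proof.
move=> z.
have comm_powers m n : (0 < m)%N -> (0 < n)%N ->
    exists g, word_map (comm (F2x ^+ m) (F2y ^+ n))%g g = z.
  move=> m_gt0 n_gt0; have [a [b <-]] := comm_surj z.
  have [u <-] := psl2_root a m_gt0; have [v <-] := psl2_root b n_gt0.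
  by exists (u, v); rewrite word_map_comm !word_mapX word_mapx word_mapy.
have power_comm n : (0 < n)%N -> exists g, word_map (comm F2x F2y ^+ n)%g g = z.
  move=> n_gt0; have [u <-] := psl2_root z n_gt0.
  have [a [b <-]] := comm_surj u; exists (a, b).
  by rewrite word_mapX word_map_comm word_mapx word_mapy.
case: hw => [->|[[m [n [m_gt0 n_gt0 ->]]]|[->|[[p [p_pr _ ->]]|->]]]].
- exact: (comm_powers 1%N 1%N).
- exact: comm_powers.
- exact: power_comm.
- exact: power_comm (prime_gt0 p_pr).
- exact: double_comm_word_surj.
Qed.
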